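(* Let $\boldsymbol d=(d_i)_{i\in\mathbb Z}$ and $\boldsymbol\lambda=(\lambda_i)_{i\in\mathbb Z}$ be nondecreasing sequences in $[0,1]$ with $f_{\boldsymbol d}(\alpha)<\infty$ and $f_{\boldsymbol\lambda}(\alpha)<\infty$ for all $\alpha\in(0,1)$. The sequence $\boldsymbol d$ is Riemann majorized by $\boldsymbol\lambda$ if and only if $\boldsymbol d$ satisfies interior majorization by $\boldsymbol\lambda$.
   Context: For a countable sequence $\boldsymbol d=(d_i)$ in $[0,1]$ and $\alpha\in(0,1)$, $f_{\boldsymbol d}(\alpha)=(1-\alpha)\sum_{d_i<\alpha}d_i+\alpha\sum_{d_i\ge\alpha}(1-d_i)\in[0,\infty]$. When finite it is piecewise linear on $(0,1)$; statements on derivatives at $\alpha$ mean that the functions involved are differentiable at $\alpha$. Interior majorization: for sequences $\boldsymbol d,\boldsymbol\lambda$ in $[0,1]$, $\boldsymbol d$ satisfies interior majorization by $\boldsymbol\lambda$ if $f_{\boldsymbol d}(\alpha)<\infty$ for all $\alpha\in(0,1)$, $f_{\boldsymbol d}(\alpha)\ge f_{\boldsymbol\lambda}(\alpha)$ for all $\alpha\in(0,1)$, and $f_{\boldsymbol d}'(\alpha)\equiv f_{\boldsymbol\lambda}'(\alpha)\mod 1$ for some $\alpha\in(0,1)$. Riemann majorization: for nondecreasing sequences $\boldsymbol d=(d_i)_{i\in\mathbb Z}$ and $\boldsymbol\lambda=(\lambda_i)_{i\in\mathbb Z}$ in $[0,1]$ with $f_{\boldsymbol d}(\alpha)<\infty$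 and $f_{\boldsymbol\lambda}(\alpha)<\infty$ for all $\alpha\in(0,1)$, $\boldsymbol d$ is Riemann majorized by $\boldsymbol\lambda$ if there is some $k\in\mathbb Z$ such that $\delta_m:=\sum_{i=-\infty}^m(d_{i-k}-\lambda_i)\ge0$ for all $m\in\mathbb Z$ and $\lim_{m\to\infty}\delta_m=0$.
   Formalization: Adds the hypothesis that, for each c, d is constantly c iff λ is constantly c; without it the claim fails: for d≡1, λ≡0 both f vanish on (0,1), so interior majorization holds, but every δ_m is +∞. Excluded pairs (at least one sequence constant) are never Riemann majorized. *)

(* Defs.v *)
From HB Require Import structures.
From mathcomp Require Import all_boot all_order all_algebra.
From mathcomp Require Import all_classical all_reals all_analysis.

Set Implicit Arguments.
Unset Strict Implicit.
Unset Printing Implicit Defensive.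

Import Order.TTheory GRing.Theory Num.Theory.
Import numFieldNormedType.Exports.

Local Open Scope classical_set_scope.
Local Open Scope ring_scope.

(* [\esum] is the supremum of the finite subsums, i.e., the unordered sum of a
   family of nonnegative terms: this is the intended value for d in [0, 1]. *)
Definition maj_fun (R : realType) (I : countType) (d : I -> R) (a : R) : \bar R :=
  ((1 - a)%:E * (\esum_(i in [set i | (d i < a)%R]) (d i)%:E) +
   a%:E * (\esum_(i in [set i | (a <= d i)%R]) (1 - d i)%:E))%E.

Definition maj_funR (R : realType) (I : countType) (d : I -> R) (a : R) : R :=
  fine (maj_fun d a).

Definition interior_majorization (R : realType) (I J : countType)
    (d : I -> R) (lam : J -> R) : Prop :=
  [/\ forall a : R, 0 < a < 1 -> (maj_fun d a < +oo)%E,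
      forall a : R, 0 < a < 1 -> (maj_fun lam a <= maj_fun d a)%E &
      exists a : R, [/\ 0 < a < 1,
        derivable (maj_funR d) a 1, derivable (maj_funR lam) a 1 &
        exists n : int,
          (maj_funR d)^`()%classic a - (maj_funR lam)^`()%classic a = n%:~R]].

(* Partial sums, over m - n < i <= m, of the series in i running from m down
   to -oo. *)
Definition delta_psum (R : realType) (d lam : int -> R) (k m : int) : R ^nat :=
  series (fun j : nat => d (m - j%:Z - k) - lam (m - j%:Z)).

Definition delta (R : realType) (d lam : int -> R) (k m : int) : R :=
  limn (delta_psum d lam k m).

(* Convergence of the series defining [delta] is required explicitly, since
   [limn] returns a default value on divergent sequences. *)
Definition riemann_majorized (R : realType) (d lam : int -> R) : Prop :=
  exists k : int,
    [/\ forall m : int, cvgn (delta_psum d lam k m),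
        forall m : int, 0 <= delta d lam k m &
        delta d lam k n%:Z @[n --> \oo] --> (0 : R)].

(* Nondegeneracy: d and lam are constant, with the same value, simultaneously;
   it holds as soon as neither sequence is constant. When maj_fun d is finite
   on (0, 1), a nondecreasing d : int -> [0, 1] is constantly 0, constantly 1,
   or tends to 0 at -oo and to 1 at +oo. If d and lam are of different kinds
   then d is not Riemann majorized by lam, although interior majorization can
   hold: for d = 1 and lam = 0 both functions vanish on (0, 1), while [delta]
   would be an infinite sum of ones. *)
Definition same_constants (R : realType) (d lam : int -> R) : Prop :=
  forall c : R, (forall i, d i = c) <-> (forall i, lam i = c).

(* Main.v *)
(* For d not constant put L_n = sum_{i <= n} d_i and U_n = sum_{i > n} (1 - d_i).
   Then U_n - L_n = C_d - n for a constant C_d, and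
   (1 - a) L_n + a U_n = L_n + a (C_d - n) is minimal in n, with value f_d(a),
   as soon as d_n <= a <= d_{n+1}. So f_d is piecewise linear with slopes in
   C_d + Z, and the congruence of derivatives says that k = C_lam - C_d is an
   integer. For this k, delta_m = L^d_{m-k} - L^lam_m, whose limit at +oo is
   C_lam - C_d - k = 0. Finally f_d - a C_lam and f_lam - a C_lam are the minima
   over m of L^d_{m-k} - a m and L^lam_m - a m; choosing a between lam_m and
   lam_{m+1} recovers L^lam_m <= L^d_{m-k} from f_lam <= f_d. *)

Require Import Defs.
From HB Require Import structures.
From mathcomp Require Import all_boot all_order all_algebra.
From mathcomp Require Import all_classical all_reals all_analysis.
From mathcomp Require Import zify ring lra.

Set Implicit Arguments.
Unset Strict Implicit.
Unset Printing Implicit Defensive.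

Import Order.TTheory GRing.Theory Num.Theory.
Import numFieldNormedType.Exports.

Local Open Scope classical_set_scope.
Local Open Scope ring_scope.

(** * Sums over the integers running down to [-oo] *)

Definition tail_sum (R : realType) (g : int -> R) (n : int) : R :=
  limn (series (fun j : nat => g (n - j%:Z))).

Definition summable_left (R : realType) (g : int -> R) : Prop :=
  forall n : int, cvgn (series (fun j : nat => g (n - j%:Z))).

(** Reflection turns sums running to [+oo] into sums running to [-oo], so the lemmas on [tail_sum]
    serve both ends. *)
Definition mirror (R : realType) (d : int -> R) (i : int) : R := 1 - d (- i).

Lemma int_up_down (P : int -> Prop) (n : int) :
  P n -> (forall m, P m -> P (m + 1)) -> (forall m, P m -> P (m - 1)) ->
  forall m, P m.
Proof.
move=> Pn up down m; rewrite -(subrK n m) addrC.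
elim/int_ind: (m - n) => [|k|k]; first by rewrite addr0.
  by move=> /up; rewrite -addrA -[k.+1]addn1 PoszD.
by move=> /down; rewrite -addrA -[k.+1]addn1 PoszD opprD.
Qed.

Lemma series_cons (V : zmodType) (u : nat -> V) (n : nat) :
  series u n.+1 = u 0%N + series (fun j => u j.+1) n.
Proof. by rewrite /series /= big_nat_recl. Qed.

Lemma cvg_series_cons (R : realType) (u : R ^nat) (l : R) :
  (series u @ \oo --> l) <-> (series (fun j => u j.+1) @ \oo --> l - u 0%N).
Proof.
have E : [sequence series u n.+1]_n
         = (fun n => u 0%N + series (fun j => u j.+1) n).
  by apply/funext => n /=; rewrite series_cons.
rewrite -(cvg_shiftS (series u)) E; split => H.
  have -> : series (fun j => u j.+1)
            = (fun n => (u 0%N + series (fun j => u j.+1) n) - u 0%N).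
    by apply/funext => n; rewrite addrAC subrr add0r.
  by apply: cvgB H _; exact: cvg_cst.
rewrite -(subrKC (u 0%N) l).
by apply: cvgD H; exact: cvg_cst.
Qed.

Lemma tail_index (n : int) (j : nat) : n + 1 - j.+1%:Z = n - j%:Z.
Proof. lia. Qed.

Lemma cvg_tail_step (R : realType) (g : int -> R) (n : int) (l : R) :
  (series (fun j : nat => g (n + 1 - j%:Z)) @ \oo --> l) <->
  (series (fun j : nat => g (n - j%:Z)) @ \oo --> l - g (n + 1)).
Proof.
rewrite cvg_series_cons subr0.
by under [X in series X]eq_fun do rewrite tail_index.
Qed.

Lemma summable_left_at (R : realType) (g : int -> R) (n : int) :
  cvgn (series (fun j : nat => g (n - j%:Z))) -> summable_left g.
Proof.
move=> cn; apply: (int_up_down cn) => m cm.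
  apply: (cvgP (limn (series (fun j : nat => g (m - j%:Z))) + g (m + 1))).
  by apply/cvg_tail_step; rewrite addrK.
move: cm; rewrite -{1}(subrK 1 m) => /cvg_tail_step cm.
exact: cvgP cm.
Qed.

Lemma tail_sumS (R : realType) (g : int -> R) (n : int) :
  summable_left g -> tail_sum g (n + 1) = tail_sum g n + g (n + 1).
Proof.
move=> sg; apply/eqP; rewrite -subr_eq; apply/eqP; apply/esym.
by apply: cvg_lim => //; apply/cvg_tail_step; exact: sg.
Qed.

Lemma tail_sum_ge0 (R : realType) (g : int -> R) (n : int) :
  (forall i, 0 <= g i) -> summable_left g -> 0 <= tail_sum g n.
Proof.
move=> g0 sg; apply: limr_ge; first exact: sg.
by apply: nearW => m; apply: sumr_ge0.
Qed.

(** The tail at [- n] is what is left of the tail at [0] once its first [n] terms are removed. *)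
Lemma tail_sum_cvg0 (R : realType) (g : int -> R) :
  summable_left g -> tail_sum g (- n%:Z) @[n --> \oo] --> (0 : R).
Proof.
move=> sg.
have E (n : nat) :
    tail_sum g (- n%:Z) = tail_sum g 0 - series (fun j : nat => g (0 - j%:Z)) n.
  elim: n => [|n IH]; first by rewrite /series /= big_geq// subr0.
  rewrite /series /= big_nat_recr//= opprD addrA -IH.
  have := tail_sumS (- n.+1%:Z) sg.
  have -> : - n.+1%:Z + 1 = - n%:Z by lia.
  by move=> ->; rewrite sub0r addrK.
under eq_fun do rewrite E.
rewrite -(subrr (tail_sum g 0)); apply: cvgB; first exact: cvg_cst.
exact: sg.
Qed.

(** * From unordered sums to series *)

(** Terms are nonnegative, so the sum may be taken in the order given by [e]; finiteness then brings
    it down from [\bar R] to [R]. *)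
Lemma esum_tail (R : realType) (g : int -> R) (A : set int) (e : nat -> int) :
  (forall i, 0 <= g i) -> set_bij [set: nat] A e ->
  (\esum_(i in A) (g i)%:E < +oo)%E ->
  cvgn (series (g \o e)) /\
  \esum_(i in A) (g i)%:E = (limn (series (g \o e)))%:E.
Proof.
move=> g0 be; rewrite (reindex_esum _ _ _ _ be).
have -> : \esum_(i in [set: nat]) (g (e i))%:E
          = (\sum_(0 <= i <oo) (g (e i))%:E)%E.
  by rewrite nneseries_esumT => [|n]; rewrite ?lee_fin.
move=> fin; have c : cvgn (series (g \o e)).
  by apply: nnseries_is_cvg => // i; exact: g0.
split=> //; rewrite -EFin_lim//; congr (limn _); apply/funext => n.
by rewrite /series /= -sumEFin.
Qed.

Lemma esum_le_subset (R : realType) (T : choiceType) (A B : set T)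
    (a : T -> \bar R) :
  A `<=` B -> (forall i, (0 <= a i)%E) ->
  (\esum_(i in A) a i <= \esum_(i in B) a i)%E.
Proof.
move=> AB a0; rewrite esum_mkcond [leRHS]esum_mkcond; apply: le_esum => i _.
case: ifPn => [/set_mem/AB/mem_set ->//|_].
by case: ifPn.
Qed.

Lemma set_bij_le (n : int) :
  set_bij [set: nat] [set i : int | i <= n] (fun j : nat => n - j%:Z).
Proof.
split => [j _ /=|i j _ _ /=|i /= ni]; [lia | lia |].
by exists (absz (n - i)%R) => //; lia.
Qed.

Lemma set_bij_gt (n : int) :
  set_bij [set: nat] [set i : int | n < i] (fun j : nat => n + 1 + j%:Z).
Proof.
split => [j _ /=|i j _ _ /=|i /= ni]; [lia | lia |].
by exists (absz (i - n - 1)%R) => //; lia.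
Qed.

(** * Where a sequence crosses a level *)

(** Both weights [1 - a] and [a] are positive and both sums nonnegative, so an infinite sum would
    make the total infinite. *)
Lemma maj_fun_fin (R : realType) (d : int -> R) (a : R) :
  (forall i, 0 <= d i <= 1) -> 0 < a < 1 -> (maj_fun d a < +oo)%E ->
  (\esum_(i in [set i | (d i < a)%R]) (d i)%:E < +oo)%E /\
  (\esum_(i in [set i | (a <= d i)%R]) (1 - d i)%:E < +oo)%E.
Proof.
move=> d01 /andP[a0 a1]; rewrite /maj_fun.
have : (0 <= \esum_(i in [set i | (d i < a)%R]) (d i)%:E)%E.
  by apply: esum_ge0 => i _; rewrite lee_fin; case/andP: (d01 i).
have : (0 <= \esum_(i in [set i | (a <= d i)%R]) (1 - d i)%:E)%E.
  by apply: esum_ge0 => i _; rewrite lee_fin subr_ge0; case/andP: (d01 i).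
case: (\esum_(i in [set i | (d i < a)%R]) _) => [x| |];
case: (\esum_(i in [set i | (a <= d i)%R]) _) => [y| |] //= _ _.
- by move=> _; split; exact: ltry.
- by rewrite gt0_muley ?lte_fin// ltry.
- by rewrite gt0_muley ?lte_fin ?subr_gt0// ltry.
- by rewrite !gt0_muley ?lte_fin ?subr_gt0.
Qed.

Definition nonconstant_majorizable (R : realType) (d : int -> R) : Prop :=
  [/\ {homo d : i j / i <= j}, forall i, 0 <= d i <= 1,
      forall a : R, 0 < a < 1 -> (maj_fun d a < +oo)%E,
      ~ (forall i, d i = 0) & ~ (forall i, d i = 1)].

(** If every term were at least [a], the values [1 - d i] would be summable towards [-oo], hence
    tend to 0 there. By monotonicity they stay above [1 - d i0], which forces [d i0 = 1] for every
    [i0]. *)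
Lemma exists_lt (R : realType) (d : int -> R) (a : R) :
  nonconstant_majorizable d -> 0 < a < 1 -> exists i, d i < a.
Proof.
move=> [dh d01 dfin _ nd1] a01; apply: contrapT => /forallNP na; apply: nd1 => i0.
have [_ fin] := maj_fun_fin d01 a01 (dfin _ a01).
have {}fin : (\esum_(i in [set i | (i <= i0)%R]) (1 - d i)%:E < +oo)%E.
  apply: le_lt_trans fin; apply: esum_le_subset => i /=; last first.
  - by rewrite lee_fin subr_ge0; case/andP: (d01 i).
  - by move=> _; rewrite leNgt; apply/negP; exact: na.
have g0 i : 0 <= 1 - d i by rewrite subr_ge0; case/andP: (d01 i).
have [/cvg_series_cvg_0 c _] := esum_tail g0 (set_bij_le i0) fin.
apply/eqP; rewrite eq_le; case/andP: (d01 i0) => _ -> /=.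
rewrite -subr_le0 -(cvg_lim _ c)//; apply: limr_ge; first exact: cvgP c.
by apply: nearW => j /=; rewrite lerD2l lerN2; apply: dh; lia.
Qed.

Lemma exists_ge (R : realType) (d : int -> R) (a : R) :
  nonconstant_majorizable d -> 0 < a < 1 -> exists i, a <= d i.
Proof.
move=> [dh d01 dfin nd0 _] a01; apply: contrapT => /forallNP na; apply: nd0 => i0.
have [fin _] := maj_fun_fin d01 a01 (dfin _ a01).
(* [set_bij_gt] enumerates from the successor of its argument, so [i0 - 1] makes the series start at
   [i0]. *)
have {}fin : (\esum_(i in [set i | (i0 - 1 < i)%R]) (d i)%:E < +oo)%E.
  apply: le_lt_trans fin; apply: esum_le_subset => i /=; last first.
  - by rewrite lee_fin; case/andP: (d01 i).
  - by move=> _; rewrite ltNge; apply/negP; exact: na.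
have g0 i : 0 <= d i by case/andP: (d01 i).
have [/cvg_series_cvg_0 c _] := esum_tail g0 (set_bij_gt (i0 - 1)) fin.
apply/eqP; rewrite eq_le; case/andP: (d01 i0) => -> _; rewrite andbT.
rewrite -(cvg_lim _ c)//; apply: limr_ge; first exact: cvgP c.
by apply: nearW => j /=; apply: dh; lia.
Qed.

Lemma exists_crossing (R : realType) (d : int -> R) (a : R) :
  nonconstant_majorizable d -> 0 < a < 1 -> exists n, d n < a <= d (n + 1).
Proof.
move=> nd a01; have [i di] := exists_lt nd a01; have [j dj] := exists_ge nd a01.
have [dh _ _ _ _] := nd.
have ij : i < j.
  rewrite ltNge; apply/negP => /dh ji.
  by move: (le_lt_trans (le_trans dj ji) di); rewrite ltxx.
(* The least number of steps up from [i] that reaches level [a] is not 0, so the index just before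
   it is still below [a]. *)
have ex : exists k : nat, a <= d (i + k%:Z).
  by exists (absz (j - i)%R); have -> : i + (absz (j - i)%R)%:Z = j by lia.
case: (ex_minnP ex) => -[|k] ak mk.
  by move: ak; rewrite addr0 leNgt di.
exists (i + k%:Z); rewrite -addrA -PoszD addn1 ak andbT ltNge.
by apply/negP => /mk; rewrite ltnn.
Qed.

Lemma crossing_lt (R : realType) (d : int -> R) (a : R) (n : int) :
  {homo d : i j / i <= j} -> d n < a <= d (n + 1) ->
  [set i | d i < a] = [set i | i <= n].
Proof.
move=> dh /andP[dn dn1]; apply/seteqP; split => i /=; last first.
  by move=> /dh/le_lt_trans; exact.
move=> di; rewrite leNgt; apply/negP => ni.
suff /dh : n + 1 <= i by move/(le_trans dn1); rewrite leNgt di.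
lia.
Qed.

Lemma crossing_ge (R : realType) (d : int -> R) (a : R) (n : int) :
  {homo d : i j / i <= j} -> d n < a <= d (n + 1) ->
  [set i | a <= d i] = [set i | n < i].
Proof.
move=> dh cr; have := congr1 setC (crossing_lt dh cr).
have -> : ~` [set i | d i < a] = [set i | a <= d i].
  by apply/seteqP; split => i /=; rewrite leNgt => /negP.
by move=> ->; apply/seteqP; split => i /=; rewrite ltNge => /negP.
Qed.

(** * Lower and upper sums and their balance *)

Definition lower_sum (R : realType) (d : int -> R) (n : int) : R :=
  tail_sum d n.

(* [sum_{i > n} (1 - d i)]. *)
Definition upper_sum (R : realType) (d : int -> R) (n : int) : R :=
  tail_sum (mirror d) (- (n + 1)).

Lemma mirror_index (R : realType) (d : int -> R) (n : int) :
  (fun i => 1 - d i) \o (fun j : nat => n + 1 + j%:Z)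
  = (fun j : nat => mirror d (- (n + 1) - j%:Z)).
Proof. by apply/funext => j /=; rewrite /mirror opprB opprK (addrC (n + 1)). Qed.

(** At a crossing the two index sets are half-lines, so finiteness at one level gives summability at
    both ends. *)
Lemma crossing_sums (R : realType) (d : int -> R) (a : R) (n : int) :
  nonconstant_majorizable d -> 0 < a < 1 -> d n < a <= d (n + 1) ->
  [/\ summable_left d, summable_left (mirror d) &
      maj_fun d a = ((1 - a) * lower_sum d n + a * upper_sum d n)%:E].
Proof.
move=> [dh d01 dfin _ _] a01 cr.
have g0 i : 0 <= d i by case/andP: (d01 i).
have g1 i : 0 <= 1 - d i by rewrite subr_ge0; case/andP: (d01 i).
have [] := maj_fun_fin d01 a01 (dfin _ a01).
rewrite /maj_fun (crossing_lt dh cr) (crossing_ge dh cr).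
move=> /(esum_tail g0 (set_bij_le n))[c1 ->].
move=> /(esum_tail g1 (set_bij_gt n)); rewrite mirror_index => -[c2 ->].
by split; [exact: summable_left_at c1|exact: summable_left_at c2|].
Qed.

Lemma majorizable_summable (R : realType) (d : int -> R) :
  nonconstant_majorizable d -> summable_left d /\ summable_left (mirror d).
Proof.
move=> nd; have h01 : 0 < (2^-1 : R) < 1 by apply/andP; split; lra.
have [n cr] := exists_crossing nd h01.
by have [] := crossing_sums nd h01 cr.
Qed.

Lemma lower_sumS (R : realType) (d : int -> R) (n : int) :
  summable_left d -> lower_sum d (n + 1) = lower_sum d n + d (n + 1).
Proof. exact: tail_sumS. Qed.

Lemma upper_sumS (R : realType) (d : int -> R) (n : int) :
  summable_left (mirror d) ->
  upper_sum d (n + 1) = upper_sum d n - (1 - d (n + 1)).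
Proof.
move=> sd; have := tail_sumS (- (n + 1 + 1)) sd.
rewrite /upper_sum /mirror (_ : - (n + 1 + 1) + 1 = - (n + 1)); last by lia.
by move=> ->; rewrite opprK addrK.
Qed.

(* [sum_{i > n} (1 - d i) - sum_{i <= n} d i + n] does not depend on [n]. *)
Definition balance (R : realType) (d : int -> R) : R :=
  upper_sum d 0 - lower_sum d 0.

(** Passing from [n] to [n + 1] adds [d (n + 1)] to the lower sum and takes [1 - d (n + 1)] off the
    upper one: their difference drops by exactly 1. *)
Lemma upper_sumE (R : realType) (d : int -> R) (n : int) :
  nonconstant_majorizable d ->
  upper_sum d n = lower_sum d n + balance d - n%:~R.
Proof.
move=> /majorizable_summable[sl su]; move: n.
apply: (@int_up_down _ 0) => [|n IH|n IH].
- by rewrite /balance; ring.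
- by rewrite upper_sumS// lower_sumS// IH rmorphD /=; ring.
- have := upper_sumS (n - 1) su; have := lower_sumS (n - 1) sl.
  rewrite subrK IH => -> /eqP; rewrite eq_sym subr_eq => /eqP ->.
  by rewrite rmorphB /=; ring.
Qed.

Lemma lower_sum_ge0 (R : realType) (d : int -> R) (n : int) :
  nonconstant_majorizable d -> 0 <= lower_sum d n.
Proof.
move=> nd; have [sl _] := majorizable_summable nd; have [_ d01 _ _ _] := nd.
by apply: tail_sum_ge0 => // i; case/andP: (d01 i).
Qed.

Lemma upper_sum_ge0 (R : realType) (d : int -> R) (n : int) :
  nonconstant_majorizable d -> 0 <= upper_sum d n.
Proof.
move=> nd; have [_ su] := majorizable_summable nd; have [_ d01 _ _ _] := nd.
by apply: tail_sum_ge0 => // i; rewrite subr_ge0; case/andP: (d01 (- i)).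
Qed.

Lemma upper_sum_cvg0 (R : realType) (d : int -> R) :
  nonconstant_majorizable d -> upper_sum d n%:Z @[n --> \oo] --> (0 : R).
Proof.
move=> /majorizable_summable[_ /tail_sum_cvg0 c].
rewrite -(cvg_shiftS (fun n : nat => tail_sum (mirror d) (- n%:Z))) in c.
apply: cvg_trans c; apply: near_eq_cvg; apply: nearW => n /=.
by rewrite /upper_sum -PoszD addn1.
Qed.

(** * The majorization function as a lower envelope of lines *)

(** This is [(1 - a) * lower_sum d n + a * upper_sum d n] with the upper sum eliminated by
    [upper_sumE]. *)
Definition maj_line (R : realType) (d : int -> R) (n : int) (a : R) : R :=
  lower_sum d n + a * (balance d - n%:~R).

Lemma maj_fun_line (R : realType) (d : int -> R) (a : R) (n : int) :
  nonconstant_majorizable d -> 0 < a < 1 -> d n < a <= d (n + 1) ->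
  maj_fun d a = (maj_line d n a)%:E.
Proof.
move=> nd a01 cr; have [_ _ ->] := crossing_sums nd a01 cr.
by rewrite upper_sumE// /maj_line; congr (_%:E); ring.
Qed.

Lemma maj_lineS (R : realType) (d : int -> R) (a : R) (n : int) :
  summable_left d -> maj_line d (n + 1) a = maj_line d n a + (d (n + 1) - a).
Proof. by move=> sd; rewrite /maj_line lower_sumS// rmorphD /=; ring. Qed.

(** The increments [d (i + 1) - a] in the index are nonnegative from [n] on and nonpositive before
    it. *)
Lemma maj_line_min (R : realType) (d : int -> R) (a : R) (n m : int) :
  nonconstant_majorizable d -> d n <= a <= d (n + 1) ->
  maj_line d n a <= maj_line d m a.
Proof.
move=> nd /andP[dn dn1]; have [sl _] := majorizable_summable nd.
have [dh _ _ _ _] := nd.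
rewrite -(subrK n m) addrC; case: (leP 0 (m - n)) => [/gez0_abs|/ltW/lez0_abs].
  move=> <-; elim: `|m - n|%N => [|k IH]; first by rewrite addr0.
  apply: (le_trans IH).
  rewrite -[k.+1]addn1 PoszD addrA maj_lineS// lerDl subr_ge0.
  by apply: (le_trans dn1); apply: dh; lia.
move=> e; rewrite -[m - n]opprK -e; elim: `|m - n|%N => [|k IH].
  by rewrite subr0.
apply: (le_trans IH); rewrite (_ : n - k%:Z = n - k.+1%:Z + 1); last by lia.
rewrite maj_lineS// gerDl subr_le0; apply: le_trans dn; apply: dh; lia.
Qed.

Lemma maj_fun_le_line (R : realType) (d : int -> R) (a : R) (m : int) :
  nonconstant_majorizable d -> 0 < a < 1 ->
  (maj_fun d a <= (maj_line d m a)%:E)%E.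
Proof.
move=> nd a01; have [n cr] := exists_crossing nd a01.
rewrite (maj_fun_line nd a01 cr) lee_fin; apply: maj_line_min => //.
by case/andP: cr => /ltW -> ->.
Qed.

(** Allowing [d m = a] covers plateaus [d m = d (m + 1)], where no level is crossed at [m]. The line
    of [m] and that of the true crossing are both minimal at [a], hence agree there. *)
Lemma maj_fun_eq_line (R : realType) (d : int -> R) (a : R) (m : int) :
  nonconstant_majorizable d -> 0 < a < 1 -> d m <= a <= d (m + 1) ->
  maj_fun d a = (maj_line d m a)%:E.
Proof.
move=> nd a01 dm; apply/eqP; rewrite eq_le maj_fun_le_line//=.
have [n cr] := exists_crossing nd a01.
by rewrite (maj_fun_line nd a01 cr) lee_fin; exact: maj_line_min.
Qed.

(** For this [k] the two lines have the same slope, so their difference does not depend on [a]. *)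
Lemma maj_line_shift (R : realType) (d lam : int -> R) (k m : int) (a : R) :
  k%:~R = balance lam - balance d ->
  maj_line d (m - k) a - maj_line lam m a
  = lower_sum d (m - k) - lower_sum lam m.
Proof. by move=> kE; rewrite /maj_line rmorphB /= kE; ring. Qed.

(* The functions [maj_fun] are, up to a linear term, the Legendre transforms of
   the convex sequences of lower sums, so they are ordered like these. *)
Lemma lower_sum_le_maj_fun (R : realType) (d lam : int -> R) (k : int) :
  nonconstant_majorizable d -> nonconstant_majorizable lam ->
  k%:~R = balance lam - balance d ->
  (forall m, lower_sum lam m <= lower_sum d (m - k)) <->
  (forall a : R, 0 < a < 1 -> (maj_fun lam a <= maj_fun d a)%E).
Proof.
move=> nd nl kE; split=> [H a a01|H m].
  have [n cr] := exists_crossing nd a01.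
  rewrite (maj_fun_line nd a01 cr).
  (* Index [n + k] picks the line of [lam] parallel to the line [n] of [d]. *)
  apply: le_trans (maj_fun_le_line (n + k) nl a01) _.
  rewrite lee_fin -{2}(addrK k n) -subr_ge0 maj_line_shift// subr_ge0.
  exact: H.
have [lh l01 _ _ _] := nl.
have ll : lam m <= lam (m + 1) by apply: lh; lia.
have [/andP[l0 l1] /andP[l2 l3]] := (l01 m, l01 (m + 1)).
have [sl su] := majorizable_summable nl.
(* The midpoint [a] used at the end lies in (0, 1) unless [lam (m + 1) = 0] or [lam m = 1]. In the
   first case all terms of [lam] up to [m] vanish. *)
have [lm1|lm1] := leP (lam (m + 1)) 0.
  suff -> : lower_sum lam m = 0 by exact: lower_sum_ge0.
  rewrite /lower_sum /tail_sum (_ : (fun j : nat => lam (m - j%:Z)) = cst 0).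
    rewrite (_ : series _ = cst 0) ?lim_cst//.
    by apply/funext => n; rewrite /series /= big1.
  apply/funext => j /=; apply/eqP; rewrite eq_le.
  case/andP: (l01 (m - j%:Z)) => -> _; rewrite andbT; apply: le_trans lm1.
  by apply: lh; lia.
(* Here [lam] is 1 from [m] on, and the claim is nonnegativity of [upper_sum d (m - k)] rewritten by
   [upper_sumE]. *)
have [lm|lm] := leP 1 (lam m).
  have u0 : upper_sum lam m = 0.
    rewrite /upper_sum /tail_sum
      (_ : (fun j : nat => mirror lam (- (m + 1) - j%:Z)) = cst 0).
      rewrite (_ : series _ = cst 0) ?lim_cst//.
      by apply/funext => n; rewrite /series /= big1.
    apply/funext => j /=; rewrite /mirror; apply/eqP; rewrite subr_eq0.
    rewrite eq_le; case/andP: (l01 (- (- (m + 1) - j%:Z))) => _ ->.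
    by rewrite andbT; apply: le_trans lm _; apply: lh; lia.
  have := upper_sum_ge0 (m - k) nd; rewrite (upper_sumE _ nd) rmorphB /= kE.
  by move: u0; rewrite (upper_sumE _ nl); lra.
pose a := (lam m + lam (m + 1)) / 2.
have a01 : 0 < a < 1 by rewrite /a; apply/andP; split; lra.
have am : lam m <= a <= lam (m + 1) by rewrite /a; apply/andP; split; lra.
have := le_trans (H a a01) (maj_fun_le_line (m - k) nd a01).
rewrite (maj_fun_eq_line nl a01 am) lee_fin -subr_ge0 maj_line_shift//.
by rewrite subr_ge0.
Qed.

(** * The partial sums of Riemann majorization *)

Lemma delta_psumE (R : realType) (d lam : int -> R) (k m : int) :
  delta_psum d lam k m =
  series ((fun j : nat => d ((m - k) - j%:Z)) - (fun j : nat => lam (m - j%:Z))).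
Proof.
rewrite /delta_psum; congr (series _); apply/funext => j.
by rewrite [in RHS]/GRing.add /= (addrAC m).
Qed.

Lemma delta_psum_cvg (R : realType) (d lam : int -> R) (k m : int) :
  summable_left d -> summable_left lam -> cvgn (delta_psum d lam k m).
Proof. by move=> sd sl; rewrite delta_psumE; apply: is_cvg_seriesB. Qed.

Lemma deltaE (R : realType) (d lam : int -> R) (k m : int) :
  summable_left d -> summable_left lam ->
  delta d lam k m = lower_sum d (m - k) - lower_sum lam m.
Proof. by move=> sd sl; rewrite /delta delta_psumE lim_seriesB. Qed.

(** * Derivatives of the majorization function *)

(* Where [maj_funR d] has a kink it is still affine on the left, so the left
   difference quotients suffice to compute the derivative if there is one. *)
Lemma derive1_left_affine (R : realType) (f : R -> R) (a b c s : R) :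
  b < a -> (forall x, b < x <= a -> f x = c + x * s) ->
  derivable f a 1 -> f^`()%classic a = s.
Proof.
move=> ba fE df; rewrite derive1E /derive cvg_at_leftE//.
apply: cvg_lim => //; apply: cvg_trans (@cvg_cst _ s _ 0^'- _).
apply: near_eq_cvg; near=> h.
have h0 : h < 0 by near: h; exact: nbhs_left_lt.
have hb : b - a < h by near: h; apply: nbhs_left_gt; rewrite subr_lt0.
rewrite /= -[h *: 1]/(h * 1) mulr1 !fE ?ba ?lexx//; last first.
  by apply/andP; split; lra.
rewrite -[_ *: _]/(_ * _); field.
by rewrite lt_eqF.
Unshelve. all: by end_near. Qed.

Lemma maj_funR_line (R : realType) (d : int -> R) (a x : R) (n : int) :
  nonconstant_majorizable d -> 0 < a < 1 -> a <= d (n + 1) ->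
  d n < x <= a -> maj_funR d x = maj_line d n x.
Proof.
move=> nd /andP[a0 a1] an /andP[dx xa]; have [_ d01 _ _ _] := nd.
have /andP[dn0 _] := d01 n.
rewrite /maj_funR (@maj_fun_line _ d x n)//; apply/andP; split=> //.
- exact: le_lt_trans dx.
- exact: le_lt_trans a1.
- exact: le_trans an.
Qed.

Lemma maj_funR_derive1 (R : realType) (d : int -> R) (a : R) (n : int) :
  nonconstant_majorizable d -> 0 < a < 1 -> d n < a <= d (n + 1) ->
  derivable (maj_funR d) a 1 -> (maj_funR d)^`()%classic a = balance d - n%:~R.
Proof.
move=> nd a01 /andP[dn an]; apply: (derive1_left_affine dn) => x xa.
exact: maj_funR_line nd a01 an xa.
Qed.

(** Strict inequalities on both sides leave a neighbourhood of [a] on which the function is a single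
    line. *)
Lemma maj_funR_derivable (R : realType) (d : int -> R) (a : R) (n : int) :
  nonconstant_majorizable d -> 0 < a < 1 -> d n < a < d (n + 1) ->
  derivable (maj_funR d) a 1.
Proof.
move=> nd /andP[a0 a1] /andP[dn an].
apply: (@near_eq_derivable _ _ _ (maj_line d n)); last first.
  have : is_derive a 1 (maj_line d n) (balance d - n%:~R).
    apply: is_derive_eq; rewrite /GRing.scale /=; ring.
  by move=> ?; exact: ex_derive.
near=> x; apply/esym.
have dx : d n < x by near: x; exact: lt_nbhsr.
have xd : x < d (n + 1) by near: x; exact: lt_nbhsl.
have x0 : 0 < x by near: x; exact: lt_nbhsr.
have x1 : x < 1 by near: x; exact: lt_nbhsl.
by rewrite (@maj_funR_line _ d x x n)// ?x0 ?dx ?lexx// ltW.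
Unshelve. all: by end_near. Qed.

Lemma common_derivable_point (R : realType) (d lam : int -> R) :
  nonconstant_majorizable d -> nonconstant_majorizable lam ->
  exists a n m, [/\ 0 < a < 1, d n < a < d (n + 1) & lam m < a < lam (m + 1)].
Proof.
move=> nd nl; have h01 : 0 < (2^-1 : R) < 1 by apply/andP; split; lra.
have [n /andP[dn dn1]] := exists_crossing nd h01.
have [m /andP[lm lm1]] := exists_crossing nl h01.
have [_ d01 _ _ _] := nd; have /andP[d0 _] := d01 n.
(* Both sequences cross 1/2, at [n] and [m]. Any level strictly between the larger of [d n], [lam m]
   and 1/2 will do; this is the midpoint. *)
exists ((Num.max (d n) (lam m) + 2^-1) / 2), n, m.
have : d n <= Num.max (d n) (lam m) by rewrite le_max lexx.
have : lam m <= Num.max (d n) (lam m) by rewrite le_max lexx orbT.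
have : Num.max (d n) (lam m) < 2^-1 by rewrite gt_max dn.
by move=> *; split; apply/andP; split; lra.
Qed.

(** * The equivalence for nonconstant sequences *)

(** The limit of [delta] is [balance lam - balance d - k], so requiring it to be 0 determines
    [k]. *)
Lemma riemann_majorizedP (R : realType) (d lam : int -> R) :
  nonconstant_majorizable d -> nonconstant_majorizable lam ->
  riemann_majorized d lam <->
  exists2 k : int, k%:~R = balance lam - balance d &
    forall m, lower_sum lam m <= lower_sum d (m - k).
Proof.
move=> nd nl; have [sd _] := majorizable_summable nd.
have [sl _] := majorizable_summable nl.
have lim k : delta d lam k n%:Z @[n --> \oo] --> balance lam - balance d - k%:~R.
  (* Upper sums replace lower sums because they tend to 0 at [+oo], where the lower sums diverge. *)
  have -> : (fun n : nat => delta d lam k n%:Z) =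
      (fun n : nat => upper_sum d (n%:Z - k) - upper_sum lam n%:Z
                      + (balance lam - balance d - k%:~R)).
    apply/funext => n; rewrite deltaE// !upper_sumE// rmorphB /=; ring.
  rewrite -[X in _ --> X]add0r; apply: cvgD; last exact: cvg_cst.
  rewrite -[X in _ --> X](subrr 0); apply: cvgB; last exact: upper_sum_cvg0.
  have c := upper_sum_cvg0 nd.
  case: (intP k) => [|p|p]; first by under eq_fun do rewrite subr0.
    rewrite -(cvg_shiftn p.+1 (fun n : nat => upper_sum d (n%:Z - p.+1%:Z))).
    by under eq_fun do rewrite PoszD addrK.
  under eq_fun do rewrite opprK -PoszD.
  by rewrite -(cvg_shiftn p.+1 (fun n : nat => upper_sum d n%:Z)) in c.
split=> [[k [_ H0 H]]|[k kE H]]; exists k.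
- apply/esym/eqP; rewrite -subr_eq0; apply/eqP.
  exact: cvg_unique (lim k) H.
- by move=> m; rewrite -subr_ge0 -deltaE.
- split=> [m|m|].
  + exact: delta_psum_cvg.
  + by rewrite deltaE// subr_ge0.
  + by move: (lim k); rewrite kE subrr.
Qed.

Lemma riemann_interior_nonconstant (R : realType) (d lam : int -> R) :
  nonconstant_majorizable d -> nonconstant_majorizable lam ->
  riemann_majorized d lam <-> interior_majorization d lam.
Proof.
move=> nd nl; rewrite (riemann_majorizedP nd nl); split.
  move=> [k kE H].
  have [a [n [m [a01 cd cl]]]] := common_derivable_point nd nl.
  have dd := maj_funR_derivable nd a01 cd.
  have dl := maj_funR_derivable nl a01 cl.
  split; [by case: nd | by apply/(lower_sum_le_maj_fun nd nl kE) |].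
  (* The slopes at [a] are [balance d - n] and [balance lam - m]; their difference is
     [m - n - k]. *)
  exists a; split=> //; exists (m - n - k).
  move: cd cl => /andP[dn /ltW dn1] /andP[lm /ltW lm1].
  rewrite (@maj_funR_derive1 _ d a n)// ?dn//.
  rewrite (@maj_funR_derive1 _ lam a m)// ?lm//.
  by rewrite !rmorphB /= kE; ring.
move=> [_ H [a [a01 dd dl [p]]]].
have [n cd] := exists_crossing nd a01; have [m cl] := exists_crossing nl a01.
rewrite (maj_funR_derive1 nd a01 cd dd) (maj_funR_derive1 nl a01 cl dl) => E.
(* The same relation between slopes, now solved for [k]. *)
have kE : (m - n - p)%:~R = balance lam - balance d.
  by rewrite !rmorphB /= -E; ring.
by exists (m - n - p) => //; apply/(lower_sum_le_maj_fun nd nl kE).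
Qed.

(** * Constant sequences and conclusion *)

Lemma maj_fun_cst (R : realType) (c a : R) :
  c = 0 \/ c = 1 -> 0 < a < 1 -> maj_fun (fun _ : int => c) a = 0%E.
Proof.
move=> c01 /andP[a0 a1]; rewrite /maj_fun.
have z (A : set int) (x : R) : (A = set0 \/ x = 0) ->
    \esum_(i in A) x%:E = 0%E.
  by move=> [->|->]; [rewrite esum_set0|rewrite esum1].
rewrite !z ?mule0 ?adde0//.
- case: c01 => ->; last by right; rewrite subrr.
  by left; apply/seteqP; split=> // i /=; rewrite leNgt a0.
- case: c01 => ->; first by right.
  by left; apply/seteqP; split=> // i /=; rewrite ltNge ltW.
Qed.

Lemma riemann_majorized_refl (R : realType) (d : int -> R) :
  riemann_majorized d d.
Proof.
exists 0.
have E m : delta_psum d d 0 m = cst 0.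
  rewrite /delta_psum; apply/funext => n; rewrite /series /= big1// => j _.
  by rewrite subr0 subrr.
have D m : delta d d 0 m = 0 by rewrite /delta E lim_cst.
split=> [m|m|]; first by rewrite E; exact: is_cvg_cst.
  by rewrite D.
under eq_fun do rewrite D; exact: cvg_cst.
Qed.

Lemma interior_majorization_cst (R : realType) (c : R) :
  c = 0 \/ c = 1 ->
  interior_majorization (fun _ : int => c) (fun _ : int => c).
Proof.
move=> c01; split=> [a a01|//|]; first by rewrite maj_fun_cst// ltry.
have h01 : 0 < (2^-1 : R) < 1 by apply/andP; split; lra.
have dc : derivable (maj_funR (fun _ : int => c)) 2^-1 1.
  apply: (@near_eq_derivable _ _ _ (cst 0)); last exact: derivable_cst.
  near=> x; rewrite /maj_funR maj_fun_cst//.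
  apply/andP; split; near: x; [apply: lt_nbhsr|apply: lt_nbhsl]; lra.
by exists 2^-1; split=> //; exists 0; rewrite subrr.
Unshelve. all: by end_near. Qed.

Theorem theorem5p3 (R : realType) (d lam : int -> R)
    (d_nondecr : {homo d : i j / i <= j})
    (lam_nondecr : {homo lam : i j / i <= j})
    (d_01 : forall i : int, 0 <= d i <= 1)
    (lam_01 : forall i : int, 0 <= lam i <= 1)
    (d_fin : forall a : R, 0 < a < 1 -> (maj_fun d a < +oo)%E)
    (lam_fin : forall a : R, 0 < a < 1 -> (maj_fun lam a < +oo)%E)
    (nondegenerate : same_constants d lam) :
  riemann_majorized d lam <-> interior_majorization d lam.
Proof.
(* Here [same_constants] makes [lam] the same constant, and both sides of the equivalence hold
   outright. *)
have cst_case c : c = 0 \/ c = 1 -> (forall i, d i = c) ->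
    riemann_majorized d lam <-> interior_majorization d lam.
  move=> c01 dc; have lc := (nondegenerate c).1 dc.
  rewrite (_ : d = fun=> c); last exact/funext.
  rewrite (_ : lam = fun=> c); last exact/funext.
  by split=> _; [exact: interior_majorization_cst|exact: riemann_majorized_refl].
have [d0|d0] := pselect (forall i, d i = 0).
  by apply: cst_case d0; left.
have [d1|d1] := pselect (forall i, d i = 1).
  by apply: cst_case d1; right.
apply: riemann_interior_nonconstant; split=> //.
- by move/(nondegenerate 0).2.
- by move/(nondegenerate 1).2.
Qed.
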